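(* Let $q$ be a power of a prime. Then $N_{q^2}(U_5(q)) = q(q-1)(2q^2+q-1)$, and for all integers $n\ge 6$ $$N_{q^2}(U_n(q)) = q\,N_{q^2}(U_{n-1}(q)) + q^{n-4}(q-1)\left[q^3+(n-5)q^2-(n-6)q-1\right].$$ Consequently, for all $n\ge 5$, $$N_{q^2}(U_n(q)) = q^{n-4}(q-1)\left\{(n-5)q^3+\left(\frac{(n-5)(n-4)}{2}+2\right)q^2+\left[1-\frac{(n-6)(n-5)}{2}\right]q-n+4\right\},$$ which is a polynomial in $q$ with integer coefficients depending only on $n$.
   Context: For a prime power $q$, $U_n(q)$ denotes the group of upper triangular $n\times n$ matrices over the finite field $\mathbf{F}_q$ all of whose diagonal entries equal $1$. For a finite group $G$ and a positive integer $k$, $N_k(G)$ denotes the number of irreducible complex characters $\chi$ of $G$ with $\chi(1)=k$. *)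

(* Defs.v *)
From HB Require Import structures.
From mathcomp Require Import all_boot all_order all_algebra all_fingroup.
From mathcomp Require Import all_solvable all_field all_character.

Set Implicit Arguments.
Unset Strict Implicit.
Unset Printing Implicit Defensive.

Import GRing.Theory.
Local Open Scope ring_scope.

(* [is_trig_mx] means lower triangular, hence the transpose. *)
Definition unitriangular_mx (R : nzRingType) (n : nat) (A : 'M[R]_n) : bool :=
  is_trig_mx A^T && [forall i, A i i == 1].

(* Elements of {'GL_n[F]} are matrices of size n.-1.+1, which is n when n > 0. *)
Definition UT (F : finFieldType) (n : nat) : {set {'GL_n[F]}} :=
  [set g | unitriangular_mx (GLval g)].

Lemma UT_group_set (F : finFieldType) (n : nat) : group_set (@UT F n).
Proof.
apply/group_setP; split=> [|g h].
  rewrite inE; apply/andP; split.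
    by rewrite /= trmx1 scalar_mx_is_trig.
  by apply/forallP=> i; rewrite mxE eqxx.
rewrite !inE => /andP[/is_trig_mxP Ug /forallP Dg].
move=> /andP[/is_trig_mxP Uh /forallP Dh]; apply/andP; split.
  apply/is_trig_mxP=> i j lt_ij; rewrite mxE mxE big1 // => k _.
  have [lt_kj | le_jk] := ltnP k j.
    by have := Ug k j lt_kj; rewrite mxE => ->; rewrite mul0r.
  have := Uh i k (leq_trans lt_ij le_jk).
  by rewrite mxE => ->; rewrite mulr0.
apply/forallP=> i; rewrite mxE (bigD1 i) //= (eqP (Dg i)) (eqP (Dh i)) mulr1.
rewrite big1 ?addr0 // => k; rewrite neq_ltn => /orP[lt_ki | lt_ik].
  by have := Ug k i lt_ki; rewrite mxE => ->; rewrite mul0r.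
by have := Uh i k lt_ik; rewrite mxE => ->; rewrite mulr0.
Qed.

Canonical UT_group (F : finFieldType) (n : nat) : {group {'GL_n[F]}} :=
  Group (UT_group_set F n).

Definition num_irr_deg (gT : finGroupType) (G : {group gT}) (k : nat) : nat :=
  #|[set i : Iirr G | 'chi[G]_i 1%g == k%:R]|.

(* Main.v *)
Require Import Defs.
From mathcomp Require Import all_boot all_order all_algebra all_fingroup.
From mathcomp Require Import all_solvable all_field all_character.
From mathcomp Require Import zify ring.

Set Implicit Arguments.
Unset Strict Implicit.
Unset Printing Implicit Defensive.

Import GroupScope Order.TTheory GRing.Theory Num.Theory.
Local Open Scope ring_scope.

(* The first row V of a group of unitriangular matrices is an abelian normal
   subgroup, complemented by the matrices H whose first row is trivial.
   Clifford theory and Gallagher's theorem count the irreducible characters of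
   V ><| H of degree k as the sum, over the H-orbits of linear characters of V,
   of the number of irreducible characters of degree k / |orbit| of the
   stabiliser.  A linear character of V is a column vector w, on which H acts by
   left multiplication.  When every w whose last nonzero entry is in place j is
   equivalent to a multiple of the j-th unit vector, the orbit has size
   q ^ (number of places before j), and the stabiliser is the pattern subgroup
   of H with column j cleared.  For k = q ^ 2 only three values of j contribute;
   iterating on the resulting pattern groups leads to counts of linear
   characters, which are powers of q. *)

(** * Characters of V ><| H for V abelian *)

(** Such an [f] is a representation by matrices of size 1, and the trace gives back [f]. *)
Lemma cfun_lin_char (gT : finGroupType) (G : {group gT}) (f : gT -> algC) :
    f 1%g = 1 -> {in G &, {morph f : x y / (x * y)%g >-> x * y}} ->
  exists2 xi : 'CF(G), xi \is a linear_char & {in G, xi =1 f}.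
Proof.
move=> f1 fM.
have repr_f: mx_repr G (fun x => (f x)%:M : 'M_1).
  split=> [|x y Gx Gy]; first by rewrite f1.
  by rewrite fM // scalar_mxM.
exists (cfRepr (MxRepresentation repr_f)) => [|x Gx].
  by rewrite qualifE /= cfRepr_char cfRepr1 eqxx.
by rewrite /cfRepr cfunE Gx /= mxtrace_scalar.
Qed.

(** By Frobenius reciprocity these are the characters of G whose restriction to V contains
    ['chi_t]. *)
Definition num_irr_over (gT : finGroupType) (G V : {group gT}) t k :=
  #|[set i in irr_constt ('Ind[G, V] 'chi_t) | 'chi[G]_i 1%g == k%:R]|.

(** Clifford correspondence: induction from the inertia group is a bijection between the characters
    over ['chi_t] and multiplies degrees by [e]. Hence there are none of degree [k] unless [e]
    divides [k]. *)
Lemma num_irr_over_Inertia (gT : finGroupType) (G V : {group gT}) t k :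
    V <| G -> let e := #|G : 'I_G['chi[V]_t]| in
  num_irr_over G t k
    = if (e %| k)%N then num_irr_over 'I_G['chi[V]_t] t (k %/ e) else 0%N.
Proof.
move=> nsVG e.
have [irrI injI imI _ _] := constt_Inertia_bijection t nsVG.
have e_gt0: (0 < e)%N by apply: indexg_gt0.
have deg s: s \in irr_constt ('Ind['I_G['chi_t]] 'chi_t) ->
    'chi_(Ind_Iirr G s) 1%g = e%:R * 'chi_s 1%g.
  by move=> As; rewrite cfIirrE ?irrI // cfInd1 ?Inertia_sub.
have imIP i : i \in irr_constt ('Ind[G] 'chi_t) ->
    exists2 s, s \in irr_constt ('Ind['I_G['chi_t]] 'chi_t) & i = Ind_Iirr G s.
  by rewrite -imI => /imsetP.
rewrite /num_irr_over; case: ifP => [/dvdnP[m ->] | not_dv]; last first.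
  apply/eqP; rewrite cards_eq0; apply/eqP/setP=> i; rewrite in_set0.
  apply/negP=> /setIdP[/imIP[s As Di] /eqP chi1].
  have:= deg s As; rewrite -Di chi1 irr1_degree -natrM => /eqP.
  by rewrite eqr_nat => /eqP Dk; rewrite Dk dvdn_mulr in not_dv.
rewrite mulnK // -[RHS](card_in_imset (f := Ind_Iirr G)); last first.
  move=> s1 s2 /setIdP[As1 _] /setIdP[As2 _]; exact: injI.
apply: eq_card => i; apply/setIdP/imsetP=> [[/imIP[s As ->]] | [s /setIdP[As chi1] ->]].
  rewrite deg // mulnC natrM.
  rewrite (inj_eq (mulfI _)) ?pnatr_eq0 -?lt0n // => chi1.
  by exists s => //; apply/setIdP.
split; last by rewrite deg // (eqP chi1) -natrM mulnC eqxx.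
by have := imset_f (Ind_Iirr G) As; rewrite imI.
Qed.

(** Put [c (v * k) = xi v] for [v] in V and [k] in K; the invariance of [xi] makes this
    multiplicative. *)
Lemma invariant_lin_char_extends (gT : finGroupType) (V K T : {group gT}) xi :
    V ><| K = T -> xi \is a linear_char -> T \subset 'I[xi : 'CF(V)] ->
  exists2 c : Iirr T, 'chi_c 1%g = 1 & 'Res[V] 'chi_c = xi.
Proof.
move=> defT lin_xi /subsetP invT; have [nsVT /= sKT _ _ tiVK] := sdprod_context defT.
have [sVT nVT] := andP nsVT.
have divV x: x \in T -> divgr V K x \in V.
  by move=> Tx; rewrite mem_divgr // (sdprodW defT).
have remK x: x \in T -> remgr V K x \in K.
  by move=> Tx; rewrite mem_remgr // (sdprodW defT).
have [c lin_c Dc]: exists2 c : 'CF(T), c \is a linear_char &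
    {in T, c =1 fun x => xi (divgr V K x)}.
  apply: cfun_lin_char.
    by rewrite -(mul1g 1%g) divgrMid ?lin_char1.
  move=> x y Tx Ty /=; set a := divgr V K x; set b := divgr V K y.
  have [Va Vb]: a \in V /\ b \in V by rewrite !divV.
  have Kx := remK x Tx; have Tx' := groupVr (subsetP sKT _ Kx).
  have Vbx: (b ^ (remgr V K x)^-1)%g \in V by rewrite memJ_norm ?(subsetP nVT).
  (* Moving the K-part of [x] past [b] conjugates [b], which leaves its value under [xi]
     unchanged. *)
  have ->: (x * y = a * b ^ (remgr V K x)^-1 * (remgr V K x * remgr V K y))%g.
    rewrite {1}(divgr_eq V K x) {1}(divgr_eq V K y) -/a -/b conjgE invgK.
    by rewrite !mulgA !mulgKV.
  have Kxy: (remgr V K x * remgr V K y)%g \in K by rewrite groupM ?remK.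
  rewrite (divgrMid tiVK (groupM Va Vbx) Kxy) (lin_charM lin_xi Va Vbx).
  by rewrite inertia_valJ ?invT.
have [i Di] := irrP (lin_char_irr lin_c).
exists i; first by rewrite -Di lin_char1.
apply/cfun_inP=> v Vv; rewrite cfResE // -Di Dc ?(subsetP sVT) //.
by rewrite -{1}(mulg1 v) divgrMid.
Qed.

(** Gallagher: the characters over ['chi_t] are the products of an extension [c] with the characters
    of [T / V], that is, of K. Since [c] is linear, degrees are preserved. *)
Lemma num_irr_over_invariant (gT : finGroupType) (V K T : {group gT}) t k :
    V ><| K = T -> 'chi[V]_t \is a linear_char -> T \subset 'I['chi_t] ->
  num_irr_over T t k = num_irr_deg K k.
Proof.
move=> defT lin_t invT; have [nsVT _ _ _ _] := sdprod_context defT.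
have [c c1 cVt] := invariant_lin_char_extends defT lin_t invT.
have [irrM injM imM _] := constt_Ind_ext nsVT cVt.
pose g b := quo_Iirr V (sdprod_Iirr defT b).
have modg b: mod_Iirr (g b) = sdprod_Iirr defT b.
  by rewrite quo_IirrK // sdprod_IirrE cfker_sdprod.
have injg: injective g.
  by move=> b1 b2 /(congr1 (@mod_Iirr _ T V)); rewrite !modg; apply: sdprod_Iirr_inj.
have deg b: 'chi_(mul_mod_Iirr c (g b)) 1%g = 'chi_b 1%g.
  by rewrite cfIirrE // cfunE c1 mulr1 modg sdprod_IirrE cfSdprod1.
rewrite /num_irr_over /num_irr_deg.
rewrite -(card_imset _ (inj_comp injM injg)); apply: eq_card => i.
apply/setIdP/imsetP=> [[] | [b]].
  rewrite -/(i \in irr_constt _) imM => /codomP[b ->] chi1.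
  have Db: g (Res_Iirr K (mod_Iirr b)) = b.
    rewrite /g sdprod_Res_IirrK ?mod_IirrK //.
    by rewrite mod_IirrE ?cfker_mod.
  by exists (Res_Iirr K (mod_Iirr b)); rewrite /= ?Db // inE -deg Db.
rewrite inE -deg => chi1 ->; split=> //.
by have := codom_f (mul_mod_Iirr c) (g b); rewrite -imM.
Qed.

(** V fixes its own class functions, so Dedekind's modular law applies. *)
Lemma Inertia_sdprod (gT : finGroupType) (V H G : {group gT}) (xi : 'CF(V)) :
  V ><| H = G -> V ><| 'I_H[xi] = 'I_G[xi].
Proof.
move=> defG; have [nsVG /= sHG VH nVH tiVH] := sdprod_context defG.
rewrite sdprodE ?(subset_trans (subsetIl _ _)) //; last first.
  by apply/trivgP; rewrite -tiVH setIS ?subsetIl.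
by rewrite group_modl ?sub_inertia // VH.
Qed.

Lemma num_irr_over_sdprod (gT : finGroupType) (V H G : {group gT}) t k :
    V ><| H = G -> abelian V -> let e := #|G : 'I_G['chi[V]_t]| in
  num_irr_over G t k
    = if (e %| k)%N then num_irr_deg 'I_H['chi[V]_t] (k %/ e) else 0%N.
Proof.
move=> defG abV; have [nsVG _ _ _ _] := sdprod_context defG.
rewrite num_irr_over_Inertia //=; case: ifP => // _.
apply: num_irr_over_invariant; first exact: Inertia_sdprod defG.
  exact: char_abelianP.
exact: subsetIr.
Qed.

(* Each irreducible character of G lies over one G-orbit in Irr(V). *)
Lemma num_irr_deg_sum_over (gT : finGroupType) (G V : {group gT}) k :
    V <| G ->
  (num_irr_deg G k)%:R
    = \sum_(t : Iirr V) (num_irr_over G t k)%:R / #|G : 'I_G['chi_t]|%:R :> rat.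
Proof.
move=> nsVG; pose S := [set i : Iirr G | 'chi_i 1%g == k%:R].
pose B t := irr_constt ('Ind[G, V] 'chi_t).
have over t : (num_irr_over G t k)%:R = \sum_(i in S | i \in B t) 1 :> rat.
  rewrite sumr_const /num_irr_over; congr _%:R; apply: eq_card => i.
  by apply/setIdP/andP=> [[Bi]|[]]; rewrite inE //; split.
(* Each [i] lies over exactly one orbit, and each member of that orbit has as weight the inverse of
   the orbit size, so every inner sum is 1. *)
transitivity (\sum_(i in S) \sum_(t | i \in B t) #|G : 'I_G['chi_t]|%:R^-1 : rat).
  rewrite (eq_bigr (fun=> 1)) ?sumr_const // => i _.
  have [t Bt]: exists t, i \in B t.
    have [t Rt] := constt_cfRes_irr V i.
    by exists t; rewrite constt_Ind_Res.
  have orb s : (i \in B s) = (s \in cfclass_Iirr G t).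
    move: Bt; rewrite /B !constt_Ind_Res cfclass_IirrE => Bt.
    have DR := Clifford_Res_sum_cfclass nsVG Bt.
    rewrite irr_consttE DR cfdotZl reindex_cfclass //= cfdot_suml.
    rewrite mulf_eq0 negb_or -irr_consttE Bt /=.
    have [s_t | s'_t] := boolP (_ \in _).
      rewrite (bigD1 s) //= cfnorm_irr big1 ?addr0 ?oner_eq0 // => j /andP[_ j's].
      by rewrite cfdot_irr (negbTE j's).
    rewrite big1 ?eqxx // => j jt; rewrite cfdot_irr.
    by case: eqP => // Dj; rewrite -Dj jt in s'_t.
  rewrite (eq_bigl _ _ orb).
  rewrite (eq_bigr (fun=> #|G : 'I_G['chi_t]|%:R^-1)) => [|s].
    rewrite sumr_const card_cfclass_Iirr // -[LHS]mulr_natl mulfV //.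
    by rewrite pnatr_eq0 -lt0n indexg_gt0.
  rewrite -eq_cfclass_IirrE -!card_cfclass_Iirr // => /eqP Ds.
  by rewrite Ds.
under [RHS]eq_bigr do rewrite over mulr_suml.
rewrite (exchange_big_dep (mem S)) //= => [|t i _ /andP[] //].
apply: eq_bigr => i Si; apply: eq_big => [t|t _]; last by rewrite mul1r.
by rewrite Si.
Qed.

(** Count and index are constant on the orbit, and the index is the size of the orbit. *)
Lemma sum_num_irr_over_cfclass (gT : finGroupType) (G V : {group gT}) r k :
    V <| G ->
  \sum_(t in cfclass_Iirr G r) (num_irr_over G t k)%:R / #|G : 'I_G['chi[V]_t]|%:R
    = (num_irr_over G r k)%:R :> rat.
Proof.
move=> nsVG.
rewrite (eq_bigr (fun=> (num_irr_over G r k)%:R / #|G : 'I_G['chi_r]|%:R)) => [|t].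
  rewrite sumr_const card_cfclass_Iirr // -[LHS]mulr_natr divfK //.
  by rewrite pnatr_eq0 -lt0n indexg_gt0.
move=> r_t; rewrite -!card_cfclass_Iirr //.
have /eqP-> : cfclass_Iirr G t == cfclass_Iirr G r by rewrite eq_cfclass_IirrE.
by rewrite /num_irr_over (cfclass_Ind nsVG (psi := 'chi_t)) // -cfclass_IirrE.
Qed.

(** * Pattern groups *)

Section PatternGroup.

Variables (F : finFieldType) (n : nat).
Implicit Types (S : rel nat) (g h : {'GL_n.+1[F]}) (i j k : 'I_n.+1).

Lemma GL_mul_entry g h i j : GLval (g * h)%g i j = \sum_k g i k * h k j.
Proof. by rewrite GL_MxE mxE. Qed.

Lemma GL_one_entry i j : GLval (1%g : {'GL_n.+1[F]}) i j = (i == j)%:R.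
Proof. by rewrite GL_1E mxE. Qed.

Lemma GL_eqP g h : (forall i j, g i j = h i j) -> g = h.
Proof. by move=> eq_gh; apply/val_inj/matrixP. Qed.

Lemma mul_unit_row g h i j :
  (forall k, g i k = (i == k)%:R) -> GLval (g * h)%g i j = h i j.
Proof.
move=> gi; rewrite GL_mul_entry (bigD1 i) //= gi eqxx mul1r big1 ?addr0 // => k.
by rewrite gi eq_sym => /negbTE->; rewrite mul0r.
Qed.

(** Transitivity gives closure under products; the inequality makes the matrices unitriangular. *)
Definition pattern_rel S := transitive S /\ forall i j : nat, S i j -> (i < j)%N.

Definition pattern_set S : {set {'GL_n.+1[F]}} :=
  [set g : {'GL_n.+1[F]} |
    [forall i : 'I_n.+1, forall j : 'I_n.+1, S i j || (g i j == (i == j)%:R)]].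

(* Taking the generated group makes this a group for every S; it has the same
   elements as [pattern_set S] when [pattern_rel S] holds. *)
Definition pattern_group S := <<pattern_set S>>%G.

Lemma pattern_rel_irr S i : pattern_rel S -> S i i = false.
Proof. by case=> _ ltS; apply/negP=> /ltS; rewrite ltnn. Qed.

Lemma pattern_setP S g :
  reflect (forall i j, ~~ S i j -> g i j = (i == j)%:R) (g \in pattern_set S).
Proof.
rewrite inE; apply: (iffP forallP) => [gS i j | gS i].
  by have /forallP/(_ j) := gS i; case: (S i j) => //= /eqP.
by apply/forallP=> j; case: (boolP (S i j)) => //= /gS/eqP.
Qed.

Lemma pattern_group_set S : pattern_rel S -> group_set (pattern_set S).
Proof.
move=> pS; have [trS ltS] := pS; apply/group_setP; split.
  by apply/pattern_setP=> i j _; rewrite GL_one_entry.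
move=> g h /pattern_setP gS /pattern_setP hS; apply/pattern_setP=> i j nSij.
(* The identity entry is written as an entry of [1 * 1], so that the two sums agree term by term. *)
rewrite GL_mul_entry -(GL_one_entry i j) -[1%g in RHS]mul1g GL_mul_entry.
apply: eq_bigr => k _; rewrite !GL_one_entry.
have [<- | k'i] := eqVneq i k; first by rewrite gS ?hS ?eqxx ?pattern_rel_irr.
have [Dk | k'j] := eqVneq k j; first by rewrite -Dk in nSij *; rewrite gS ?(negbTE k'i) ?mul0r.
have [Sik | nSik] := boolP (S i k); last by rewrite gS // (negbTE k'i) !mul0r.
rewrite [GLval h k j]hS ?(negbTE k'j) ?mulr0 //.
by apply: contra nSij; apply: trS.
Qed.

Lemma pattern_groupP S g : pattern_rel S ->
  reflect (forall i j, ~~ S i j -> g i j = (i == j)%:R) (g \in pattern_group S).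
Proof.
move=> pS; rewrite /pattern_group /= (gen_set_id (pattern_group_set pS)).
exact: pattern_setP.
Qed.

Lemma eq_pattern_group S1 S2 :
    (forall i j, S1 i j = S2 i j) -> pattern_group S1 = pattern_group S2.
Proof.
move=> eqS; apply/group_inj; congr <<_>>%g; apply/setP=> g; rewrite !inE.
by apply: eq_forallb => i; apply: eq_forallb => j; rewrite eqS.
Qed.

(** Exhibits group elements through their entries; such a matrix is triangular of determinant 1. *)
Lemma pattern_matrix S (A : 'M[F]_n.+1) : pattern_rel S ->
    (forall i j, ~~ S i j -> A i j = (i == j)%:R) ->
  exists2 g, g \in pattern_group S & forall i j, GLval g i j = A i j.
Proof.
move=> pS AS; have [_ ltS] := pS.
have uA : A \in unitmx.
  rewrite unitmxE -det_tr det_trig.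
    rewrite big1 ?unitr1 // => i _.
    by rewrite mxE AS ?eqxx ?pattern_rel_irr.
  apply/is_trig_mxP=> i j lt_ij; rewrite mxE AS.
    by case: eqP lt_ij => // ->; rewrite ltnn.
  by apply/negP=> /ltS; rewrite ltnNge ltnW.
exists (FinRing.unit _ uA : {'GL_n.+1[F]}); last by [].
by apply/(pattern_groupP _ pS).
Qed.

(** A copy of the unitriangular group on the indices from [a] on. Keeping all patterns inside one
    matrix group lets rows be removed without changing the matrix size. *)
Definition triangle (a : nat) : rel nat := fun i j : nat => (a <= i)%N && (i < j)%N.

Lemma triangle_rel a : pattern_rel (triangle a).
Proof. by rewrite /triangle; split=> [j i k|i j]; lia. Qed.

Lemma UT_pattern : UT_group F n.+1 = pattern_group (triangle 0).
Proof.
apply/group_inj/setP=> g; rewrite inE.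
apply/andP/(pattern_groupP _ (triangle_rel 0)) => /=.
  move=> [/is_trig_mxP Ug /forallP Dg] i j; rewrite -leqNgt leq_eqVlt.
  have [<- _ | j'i /orP[/eqP/val_inj Dj|lt_ji]] := eqVneq i j; first exact/eqP.
    by rewrite Dj eqxx in j'i.
  by have := Ug j i lt_ji; rewrite mxE.
move=> gS; split; last by apply/forallP=> i; rewrite gS ?eqxx // /triangle ltnn.
apply/is_trig_mxP=> i j lt_ij; rewrite mxE gS /triangle -?leqNgt 1?ltnW //.
by case: eqP lt_ij => // ->; rewrite ltnn.
Qed.

End PatternGroup.

Arguments pattern_group : simpl never.

Arguments pattern_groupP {F n S g}.

(** * Splitting off the top row *)

Definition row_rel (S : rel nat) (a : nat) : rel nat :=
  fun i j => (i == a) && S i j.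

Definition del_row (S : rel nat) (a : nat) : rel nat :=
  fun i j => (i != a) && S i j.

(* The pattern of the stabiliser in H of a linear character of V supported at the
   single place j of row a. *)
Definition stab_rel (S : rel nat) (a j : nat) : rel nat :=
  fun i l => del_row S a i l && ~~ ((l == j) && S a i).

Lemma del_row_rel S a : pattern_rel S -> pattern_rel (del_row S a).
Proof.
rewrite /del_row => -[trS ltS]; split=> [j i k /andP[-> Sij] /andP[_ Sjk] | i j /andP[_ /ltS] //].
exact: trS Sij Sjk.
Qed.

Lemma row_rel_rel S a : pattern_rel S -> pattern_rel (row_rel S a).
Proof.
rewrite /row_rel => -[trS ltS]; split=> [j i k /andP[-> Sij] /andP[_ Sjk] | i j /andP[_ /ltS] //].
exact: trS Sij Sjk.
Qed.

(** Any nontrivial character of the additive group works, since for [b != 0] the products [x * b]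
    run over all of F. *)
Lemma nontrivial_add_char (F : finFieldType) :
  exists psi : F -> algC,
    [/\ forall x y, psi (x + y) = psi x * psi y, psi 0 = 1
      & forall b, b != 0 -> exists x, psi (x * b) != 1].
Proof.
have abF: abelian [set: F] by exact: FinRing.zmod_abelian.
have gt1: (1 < Nirr [set: F])%N.
  have := abF; rewrite card_classes_abelian NirrE => /eqP->.
  by rewrite cardsT card_finNzRing_gt1.
pose i : Iirr [set: F] := Ordinal gt1; have nz_i: i != 0 by [].
have lin_i: 'chi_i \is a linear_char by apply: char_abelianP.
have ex0: exists x0, 'chi_i x0 != 1.
  apply/existsP/contraT; rewrite negb_exists => /forallP i1.
  case/negP: nz_i; rewrite -irr_eq1; apply/eqP/cfun_inP=> x _.
  by rewrite cfun1E inE; apply/eqP; have := i1 x; rewrite negbK.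
exists (fun x => 'chi_i x); split=> [x y||b nz_b].
- by rewrite -lin_charM ?inE.
- exact: lin_char1.
by have [x0 i_x0] := ex0; exists (x0 / b); rewrite divfK.
Qed.

Lemma card_ord_interval s m (j : 'I_m) : #|[pred i : 'I_m | (s <= i < j)%N]| = (j - s)%N.
Proof.
have lt_m (i : 'I_(j - s)) : (s + i < m)%N.
  by rewrite (ltn_trans _ (ltn_ord j)) // -ltn_subRL.
rewrite -[RHS]card_ord -(card_imset (f := fun i => Ordinal (lt_m i)) predT).
  apply: eq_card => i; rewrite inE; apply/idP/imsetP=> [/andP[le_si lt_ij] | [k _ ->]].
    have lt_is: (i - s < j - s)%N by rewrite ltn_sub2r // (leq_ltn_trans le_si).
    by exists (Ordinal lt_is) => //; apply: val_inj; rewrite /= subnKC.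
  by rewrite /= leq_addr -ltn_subRL /=.
by move=> i k /(congr1 val)/= /addnI/val_inj.
Qed.

Section Row.

Variables (F : finFieldType) (n : nat) (S : rel nat) (a : 'I_n.+1).
Hypothesis pS : pattern_rel S.
Hypothesis minS : forall i, ~~ S i a.

Let G := pattern_group F n S.
Let V := pattern_group F n (row_rel S a).
Let H := pattern_group F n (del_row S a).
Implicit Types (g h v : {'GL_n.+1[F]}) (i j k : 'I_n.+1).

Let pV := row_rel_rel a pS.
Let pH := del_row_rel a pS.

Lemma row_groupP v :
  v \in V <-> v \in G /\ forall i j, i != a -> v i j = (i == j)%:R.
Proof.
split=> [/(pattern_groupP pV) vV | [/(pattern_groupP pS) vG va]].
  split; last by move=> i j nia; apply: vV; rewrite /row_rel (inj_eq val_inj) (negbTE nia).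
  by apply/(pattern_groupP pS)=> i j nSij; apply: vV; rewrite negb_and nSij orbT.
apply/(pattern_groupP pV)=> i j; rewrite negb_and (inj_eq val_inj).
by case/orP=> [/va-> | /vG->].
Qed.

Lemma del_row_groupP h :
  h \in H <-> h \in G /\ forall j, h a j = (a == j)%:R.
Proof.
split=> [/(pattern_groupP pH) hH | [/(pattern_groupP pS) hG ha]].
  split; last by move=> j; apply: hH; rewrite /del_row eqxx.
  by apply/(pattern_groupP pS)=> i j nSij; apply: hH; rewrite negb_and nSij orbT.
apply/(pattern_groupP pH)=> i j; rewrite negb_and negbK (inj_eq val_inj).
by case/orP=> [/eqP-> // | /hG->].
Qed.

(** Outside row [a] the matrix [v2] is trivial, so only the terms at [a] and [j] survive: V is an
    additive group of row vectors. *)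
Lemma row_mul_entry v1 v2 j : v1 \in V -> v2 \in V -> S a j ->
  GLval (v1 * v2)%g a j = v1 a j + v2 a j.
Proof.
move=> V1 V2 Saj; have a'j: a != j by apply: contraTneq Saj => <-; apply: minS.
have /row_groupP[G1 v1E] := V1; have /row_groupP[G2 v2E] := V2.
rewrite GL_mul_entry (bigD1 a) //= (bigD1 j) 1?eq_sym //= (v2E j j) 1?eq_sym // eqxx mulr1.
rewrite (pattern_groupP pS G1 a a) // eqxx mul1r addrCA addrA -[RHS]addr0; congr (_ + _).
rewrite big1 // => k /andP[ka kj].
by rewrite v2E // (negbTE kj) mulr0.
Qed.

Lemma row_group_eq v1 v2 : v1 \in V -> v2 \in V ->
  (forall j, S a j -> v1 a j = v2 a j) -> v1 = v2.
Proof.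
move=> /row_groupP[G1 v1E] /row_groupP[G2 v2E] eqv; apply: GL_eqP => i j.
have [-> | i'a] := eqVneq i a; last by rewrite v1E ?v2E.
have [/eqv // | nSaj] := boolP (S a j).
by rewrite (pattern_groupP pS G1) ?(pattern_groupP pS G2).
Qed.

Lemma row_group_abelian : abelian V.
Proof.
apply/centsP=> v1 V1 v2 V2; apply: row_group_eq; rewrite ?groupM // => j Saj.
by rewrite !row_mul_entry // addrC.
Qed.

Lemma sdprod_row : V ><| H = G.
Proof.
have sVG: V \subset G by apply/subsetP=> v /row_groupP[].
have sHG: H \subset G by apply/subsetP=> h /del_row_groupP[].
have VH1: V :&: H = 1%g.
  apply/trivgP/subsetP=> g /setIP[/row_groupP[_ gV] /del_row_groupP[_ gH]].
  rewrite inE; apply/eqP/GL_eqP=> i j; rewrite GL_one_entry.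
  by have [-> | i'a] := eqVneq i a; rewrite ?gH ?gV.
have nVH: H \subset 'N(V).
  apply/subsetP=> h Hh; rewrite inE; apply/subsetP=> _ /imsetP[v Vv ->].
  have Gh := subsetP sHG h Hh; apply/row_groupP; split; first exact: groupJ (subsetP sVG _ Vv) Gh.
  (* Compared term by term with [h^-1 * h]: at [k = a] the entry of [h^-1] vanishes because column
     [a] is empty, and at other [k] row [k] of [v] is trivial. *)
  move=> i j i'a; rewrite conjgE -(GL_one_entry F i j) -(mulVg h) !GL_mul_entry.
  apply: eq_bigr => k _; have [-> | k'a] := eqVneq k a.
    rewrite (pattern_groupP pS (groupVr Gh)) ?minS //.
    by rewrite (negbTE i'a) !mul0r.
  by rewrite (mul_unit_row h) // => l; have /row_groupP[_ ->] := Vv.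
rewrite sdprodE //; apply/eqP; rewrite eqEsubset mul_subG //=.
apply/subsetP=> g Gg; have gS := pattern_groupP pS Gg.
(* [h] is [g] with row [a] made trivial, so [g * h^-1] differs from the identity in row [a] only. *)
pose A := \matrix_(i, j) if i == a then (i == j)%:R else GLval g i j : F.
have [h Hh hA] : exists2 h, h \in H & forall i j, GLval h i j = A i j.
  apply: pattern_matrix pH _ => i j; rewrite mxE negb_and negbK (inj_eq val_inj).
  by case: eqP => //= _ /gS.
have Gh := subsetP sHG h Hh; rewrite -(mulgKV h g) mem_mulg //.
apply/row_groupP; split; first by rewrite groupM ?groupV.
move=> i j i'a; rewrite -(GL_one_entry F i j) -(mulgV h) !GL_mul_entry.
by apply: eq_bigr => k _; rewrite hA mxE (negbTE i'a).
Qed.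

(** Pairing row [a] of [v] with the column [w] is additive in [v], so composing with [psi] gives a
    linear character. *)
Lemma exists_row_char (psi : F -> algC) :
    (forall x y, psi (x + y) = psi x * psi y) -> psi 0 = 1 ->
  exists lam : {ffun 'I_n.+1 -> F} -> Iirr V, forall w v, v \in V ->
    'chi_(lam w) v = psi (\sum_(j < n.+1 | S a j) GLval v a j * w j).
Proof.
move=> psiD psi0.
suffices /fin_all_exists[lam lamE] : forall w : {ffun 'I_n.+1 -> F}, exists t,
    forall v, v \in V -> 'chi[V]_t v = psi (\sum_(j < n.+1 | S a j) GLval v a j * w j).
  by exists lam.
move=> w.
have [xi lin_xi xiE] : exists2 xi : 'CF(V), xi \is a linear_char
    & {in V, xi =1 fun v => psi (\sum_(j < n.+1 | S a j) GLval v a j * w j)}.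
  apply: cfun_lin_char => [|v1 v2 V1 V2].
    rewrite big1 ?psi0 // => j Saj; rewrite GL_one_entry.
    have /negbTE->: a != j by apply: contraTneq Saj => <-; apply: minS.
    by rewrite mul0r.
  rewrite -psiD -big_split /=; congr (psi _); apply: eq_bigr => j Saj.
  by rewrite row_mul_entry // mulrDl.
have [t Dt] := irrP (lin_char_irr lin_xi).
by exists t => v Vv; rewrite -Dt xiE.
Qed.

(** * Linear characters of the row group as column vectors *)

Section RowChar.

Variables (psi : F -> algC) (lam : {ffun 'I_n.+1 -> F} -> Iirr V).
Hypothesis psiD : forall x y, psi (x + y) = psi x * psi y.
Hypothesis psi0 : psi 0 = 1.
Hypothesis psi_nondeg : forall b, b != 0 -> exists x, psi (x * b) != 1.
Hypothesis lamE : forall w v, v \in V ->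
  'chi_(lam w) v = psi (\sum_(j < n.+1 | S a j) GLval v a j * w j).
Implicit Types u w : {ffun 'I_n.+1 -> F}.

(** On the elementary matrix [1 + x E_aj] the character [lam w] takes the value [psi (x * w j)];
    nondegeneracy of [psi] then separates distinct entries. *)
Lemma row_char_eqP u w :
  lam u = lam w <-> forall j : 'I_n.+1, S a j -> u j = w j.
Proof.
split=> [eq_lam j Saj | eq_uw]; last first.
  apply/irr_inj/cfun_inP=> v Vv; rewrite !lamE //; congr (psi _).
  by apply: eq_bigr => j Saj; rewrite eq_uw.
apply/eqP; rewrite -subr_eq0; apply: contraT => nz_b.
have a'j: j != a by apply: contraTneq Saj => ->; apply: minS.
have [x /negP[]] := psi_nondeg nz_b.
have [v Vv vE] : exists2 v, v \in V & forall i k, GLval v i k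
    = (1%:M + x *: delta_mx a j : 'M[F]_n.+1) i k.
  apply: pattern_matrix pV _ => i k; rewrite !mxE negb_and (inj_eq val_inj).
  have [-> /= nSak | _ _] := eqVneq i a; last by rewrite mulr0 addr0.
  by case: (k =P j) nSak => [->|_ _]; rewrite ?Saj ?andbF ?mulr0 ?addr0.
have sumE y : \sum_(k < n.+1 | S a k) GLval v a k * y k = x * y j :> F.
  rewrite (bigD1 j) //= vE !mxE !eqxx eq_sym (negbTE a'j) add0r mulr1 big1 ?addr0 //.
  move=> k /andP[Sak kj]; rewrite vE !mxE eqxx (negbTE kj) mulr0 addr0.
  by case: eqP Sak => [<-|]; rewrite ?mul0r // (negbTE (minS _)).
have := lamE u Vv; rewrite eq_lam lamE // !sumE => eq_psi.
have nz_psi: psi (x * w j) != 0.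
  apply/eqP=> psi_x0; have := psiD (x * w j) (- (x * w j)).
  by rewrite psi_x0 mul0r subrr psi0 => /eqP; rewrite oner_eq0.
by rewrite -(inj_eq (mulIf nz_psi)) mul1r -psiD mulrBr subrK -eq_psi.
Qed.

Let cols := [pred j : 'I_n.+1 | S a j].
(** Vectors supported on the places of row [a]: one for each linear character of V. *)
Let W0 : pred {ffun 'I_n.+1 -> F} := pffun_on 0 cols predT.

Lemma row_char_domP w : reflect (forall j : 'I_n.+1, ~~ S a j -> w j = 0) (w \in W0).
Proof.
apply: (iffP pffun_onP) => [[/supportP w0 _] j nSaj | w0]; first exact: w0.
by split=> [|x _ //]; apply/supportP=> j; apply: w0.
Qed.

Lemma row_char_inj : {in W0 &, injective lam}.
Proof.
move=> u w /row_char_domP u0 /row_char_domP w0 /row_char_eqP eq_uw; apply/ffunP=> j.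
by have [/eq_uw // | nSaj] := boolP (S a j); rewrite u0 ?w0.
Qed.

(** By counting: V is abelian, so it has [#|V|] irreducible characters, and an element of V is
    determined by its row, which lies in [W0]. *)
Lemma row_char_image : lam @: W0 = setT.
Proof.
apply/eqP; rewrite eqEcard subsetT cardsT card_in_imset; last exact: row_char_inj.
rewrite card_ord; have := row_group_abelian; rewrite card_classes_abelian NirrE => /eqP->.
pose f v : {ffun 'I_n.+1 -> F} := [ffun j : 'I_n.+1 => if S a j then GLval v a j else 0].
rewrite -(card_in_imset (f := f) (D := V)).
  apply/subset_leq_card/subsetP=> _ /imsetP[v _ ->].
  by apply/row_char_domP=> j /negbTE nSaj; rewrite ffunE nSaj.
move=> v1 v2 V1 V2 /ffunP eqf; apply: row_group_eq V1 V2 _ => j Saj.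
by have := eqf j; rewrite !ffunE Saj.
Qed.

Lemma sum_row_char (f : Iirr V -> rat) :
  \sum_t f t = \sum_(w in W0) f (lam w).
Proof.
rewrite -(big_imset f row_char_inj) row_char_image.
by apply: eq_bigl => t; rewrite inE.
Qed.

Definition row_act h w : {ffun 'I_n.+1 -> F} :=
  [ffun i : 'I_n.+1 => \sum_j GLval h i j * w j].

(** Row [a] of [h] is trivial, so row [a] of [h * v * h^-1] is row [a] of [v] times [h^-1];
    associativity moves [h^-1] over to [w]. *)
Lemma row_char_conj w (h : FinGroup.sort {'GL_n.+1[F]}) : h \in H ->
  ('chi_(lam w) ^ h)%CF = 'chi_(lam (row_act h^-1 w)).
Proof.
move=> Hh; have nVH := sdprod_context sdprod_row; case: nVH => _ _ _ nVH _.
have /del_row_groupP[Gh' ha] := groupVr Hh.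
have nVh' : (h^-1)%g \in 'N(V) by rewrite groupV (subsetP nVH).
apply/cfun_inP=> v Vv; rewrite cfConjgE ?(subsetP nVH) //.
have Vvh: (v ^ h^-1)%g \in V by rewrite memJ_norm.
rewrite !lamE //; congr (psi _).
have /row_groupP[Gv va] := Vv.
transitivity (\sum_(j < n.+1 | S a j) \sum_k GLval v a k * (GLval h^-1%g k j * w j)).
  have -> : (v ^ h^-1 = h * v * h^-1)%g by rewrite conjgE invgK mulgA.
  apply: eq_bigr => j Saj; rewrite (GL_mul_entry (h * v)%g h^-1%g) mulr_suml.
  apply: eq_bigr => k _; rewrite mulrA mul_unit_row // => i.
  by have /del_row_groupP[_] := Hh.
rewrite exchange_big /= [RHS]big_mkcond; apply: eq_bigr => k _.
rewrite ffunE -mulr_sumr; case: ifP => [Sak | /negbT nSak].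
  (* By transitivity [S k j] puts [j] in row [a] again, so the terms outside row [a] are zero. *)
  congr (_ * _); rewrite [RHS](bigID (fun j : 'I_n.+1 => S a j)) /= [X in _ = _ + X]big1 ?addr0 //.
  move=> j nSaj; rewrite (pattern_groupP pS Gh').
    by case: eqP nSaj => [<-|]; rewrite ?Sak ?mul0r.
  by apply: contra nSaj; case: pS => trS _; apply: trS.
have [-> | k'a] := eqVneq k a; last first.
  by rewrite (pattern_groupP pS Gv) // eq_sym (negbTE k'a) mul0r.
rewrite big1 ?mulr0 // => j Saj; rewrite ha.
by case: eqP Saj => [<-|]; rewrite ?mul0r // (negbTE (minS _)).
Qed.

Lemma row_char_Inertia w (h : FinGroup.sort {'GL_n.+1[F]}) :
  h \in 'I_H['chi_(lam w)] <->
    h \in H /\ forall i : 'I_n.+1, S a i -> row_act h w i = w i.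
Proof.
have act_eq : h \in H -> (h \in 'I['chi_(lam w)]) = (lam (row_act h w) == lam w).
  move=> Hh; have [_ _ _ nVH _] := sdprod_context sdprod_row.
  rewrite -groupV inE groupV (subsetP nVH) //= row_char_conj ?groupV // invgK.
  by rewrite (inj_eq irr_inj).
split=> [/setIP[Hh] | [Hh w_h]]; last first.
  by apply/setIP; split; rewrite ?act_eq //; apply/eqP/row_char_eqP.
by rewrite act_eq // => /eqP/row_char_eqP.
Qed.

Lemma num_irr_over_row w (k : nat) :
  num_irr_over G (lam w) k
    = if (#|G : 'I_G['chi_(lam w)]| %| k)%N
      then num_irr_deg 'I_H['chi_(lam w)] (k %/ #|G : 'I_G['chi_(lam w)]|) else 0%N.
Proof. exact: num_irr_over_sdprod sdprod_row row_group_abelian. Qed.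

Lemma row_char_invariant w :
    (forall h (i : 'I_n.+1), h \in H -> S a i -> row_act h w i = w i) ->
  #|G : 'I_G['chi_(lam w)]| = 1%N /\ 'I_H['chi_(lam w)]%G = H.
Proof.
move=> w_fix; have IH: 'I_H['chi_(lam w)] = H.
  apply/eqP; rewrite eqEsubset subsetIl; apply/subsetP=> h Hh.
  by apply/row_char_Inertia; split=> // i Sai; apply: w_fix.
split; last exact: group_inj.
apply/eqP; rewrite indexg_eq1 -{1}(sdprodW sdprod_row).
by rewrite -(sdprodW (Inertia_sdprod _ sdprod_row)) IH.
Qed.

(** The places of row [a] that are not reached through another place of the row. Vectors supported
    there give exactly the invariant characters. *)
Let indec := [pred j : 'I_n.+1 | S a j && [forall k : 'I_n.+1, S a k ==> ~~ S k j]].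

(** Apart from [w i] itself, [h] adds to place [i] only entries [w j] with [S i j]; such [j] are
    decomposable, so [w j] is zero. *)
Lemma indec_fixed w : 0.-support w \subset indec ->
  forall h (i : 'I_n.+1), h \in H -> S a i -> row_act h w i = w i.
Proof.
move=> /supportP w_dec h i /del_row_groupP[Gh ha] Sai; rewrite ffunE (bigD1 i) //=.
rewrite (pattern_groupP pS Gh i i) ?(pattern_rel_irr _ pS) // eqxx mul1r.
rewrite big1 ?addr0 // => j j'i; have [Sij | nSij] := boolP (S i j).
  rewrite w_dec ?mulr0 // inE negb_and; apply/orP; right.
  by apply/forallPn; exists i; rewrite negb_imply Sai negbK.
by rewrite (pattern_groupP pS Gh) // eq_sym (negbTE j'i) mul0r.
Qed.

Lemma row_char_fixed w :
  w \in W0 -> (#|G : 'I_G['chi_(lam w)]| == 1%N) = (w \in pffun_on 0 indec predT).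
Proof.
move=> /row_char_domP w0; apply/idP/pffun_onP=> [| [w_dec _]].
  rewrite indexg_eq1 => sGI; split=> //; apply/supportP=> j /=.
  have [_ sHG _ _ _] := sdprod_context sdprod_row.
  rewrite inE negb_and => /orP[|]; first exact: w0.
  case/forallPn=> k; rewrite negb_imply negbK => /andP[Sak Skj].
  (* The elementary matrix [1 + E_kj] adds [w j] to [w k], so invariance forces [w j = 0]. *)
  have [h Hh hE] : exists2 h, h \in H & forall i l, GLval h i l
      = (1%:M + delta_mx k j : 'M[F]_n.+1) i l.
    apply: pattern_matrix pH _ => i l; rewrite !mxE negb_and negbK (inj_eq val_inj).
    have [-> | i'k] := eqVneq i k; last by rewrite addr0.
    have [-> | l'j] := eqVneq l j; last by rewrite addr0.
    by rewrite Skj orbF; case: eqP Sak => [->|//]; rewrite (negbTE (minS _)).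
  have: h \in 'I_H['chi_(lam w)].
    by rewrite inE Hh; have /setIP[] := subsetP sGI h (subsetP sHG h Hh).
  case/row_char_Inertia=> _ /(_ k Sak); rewrite ffunE.
  have k'j: k != j.
    by apply: contraTneq Skj => ->; rewrite (pattern_rel_irr _ pS).
  rewrite (bigD1 k) //= (bigD1 j) 1?eq_sym //= !hE !mxE !eqxx (negbTE k'j) addr0 mul1r.
  rewrite add0r mul1r big1 ?addr0 => [|l /andP[l'k l'j]].
    by move/(canRL (addKr _)); rewrite addNr.
  by rewrite hE !mxE eq_sym (negbTE l'k) (negbTE l'j) andbF addr0 mul0r.
by have [-> //] := row_char_invariant (indec_fixed w_dec).
Qed.

(** The index divides the degree 1, so only invariant characters of V contribute, each once for
    every linear character of H. *)
Lemma num_lin_char_row :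
  num_irr_deg G 1 = (#|F| ^ #|indec| * num_irr_deg H 1)%N.
Proof.
have [nsVG _ _ _ _] := sdprod_context sdprod_row.
apply/eqP; rewrite -(eqr_nat rat) (num_irr_deg_sum_over 1 nsVG) sum_row_char.
rewrite (eq_bigr (fun w => if w \in pffun_on 0 indec predT then (num_irr_deg H 1)%:R else 0)).
  rewrite -big_mkcondr (eq_bigl (mem (pffun_on 0 indec predT))) => [|w].
    by rewrite sumr_const card_pffun_on natrM mulr_natl.
  apply: andb_idl => /pffun_onP[/supportP w_dec _].
  apply/row_char_domP=> j nSaj; apply: w_dec.
  by rewrite inE negb_and nSaj.
move=> w Ww; case: ifPn => [/pffun_onP[w_0 _] | ].
  have [idx IH] := row_char_invariant (indec_fixed w_0).
  by rewrite num_irr_over_row idx dvdn1 eqxx divn1 divr1 IH.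
rewrite -row_char_fixed // num_irr_over_row dvdn1 => /negbTE->.
by rewrite mul0r.
Qed.

(** * Orbits when row [a] fills all places from [s] on and the triangle from [s] on is full *)

Section Chain.

Variable s : nat.
Hypothesis Sa : forall j, S a j = (s <= j)%N.
Hypothesis chainS : forall k j, (s <= k)%N -> (k < j)%N -> S k j.

(** For [c != 0] these are the vectors with last nonzero entry [c], in place [j]. *)
Let orb j (c : F) := [pred w | [&& w \in W0, w j == c &
  [forall i : 'I_n.+1, (j < i)%N ==> (w i == 0)]]].

Let orbP j c w : reflect
  [/\ w \in W0, w j = c & forall i, (j < i)%N -> w i = 0] (w \in orb j c).
Proof.
apply: (iffP and3P) => [[Ww /eqP wj /forallP w0] | [Ww wj w0]].
  by split=> // i lt_ji; apply/eqP; have := w0 i; rewrite lt_ji.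
by split=> //; [apply/eqP | apply/forallP=> i; apply/implyP=> /w0->].
Qed.

Let H_lower h i j : h \in H -> (j <= i)%N -> GLval h i j = (i == j)%:R.
Proof.
case/del_row_groupP=> Gh _ le_ji; apply: (pattern_groupP pS Gh).
by apply/negP; case: pS => _ ltS /ltS; rewrite ltnNge le_ji.
Qed.

(** H acts by upper unitriangular matrices, which keep the last nonzero entry; conversely, that
    entry suffices to adjust all earlier places freely. *)
Lemma row_char_orbit j c w :
    (s <= j)%N -> c != 0 -> w \in orb j c ->
  cfclass_Iirr G (lam w) = [set lam u | u in orb j c].
Proof.
move=> le_sj nz_c /orbP[Ww wj w0].
have [nsVG sHG VH nVH _] := sdprod_context sdprod_row.
have a_lt_s: (a < s)%N by rewrite ltnNge -Sa minS.
have conj_lam h : h \in H -> conjg_Iirr (lam w) h = lam (row_act h^-1 w).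
  by move=> Hh; apply: irr_inj; rewrite conjg_IirrE row_char_conj.
apply/setP=> t; apply/imsetP/imsetP=> [[g] | [u /orbP[Wu uj u0] ->]].
  rewrite -VH => /mulsgP[v h Vv Hh ->] ->.
  have ->: conjg_Iirr (lam w) (v * h)%g = conjg_Iirr (lam w) h.
    have [Gv Gh] := (subsetP (normal_sub nsVG) v Vv, subsetP sHG h Hh).
    by apply: irr_inj; rewrite !conjg_IirrE (cfConjgM _ nsVG Gv Gh) (cfConjg_id _ Vv).
  rewrite conj_lam //.
  (* Truncating to row [a] returns to [W0] without changing the character. *)
  pose u := [ffun i : 'I_n.+1 => if S a i then row_act h^-1 w i else 0].
  have Hh' := groupVr Hh.
  exists u; last by apply/row_char_eqP=> i Sai; rewrite [RHS]ffunE Sai.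
  apply/orbP; split=> [||i lt_ji].
  - by apply/row_char_domP=> i /negbTE nSai; rewrite ffunE nSai.
  - rewrite ffunE Sa le_sj ffunE (bigD1 j) //= (H_lower Hh') // eqxx mul1r wj.
    rewrite big1 ?addr0 // => l l'j; have [le_lj | lt_jl] := leqP l j.
      by rewrite (H_lower Hh') // eq_sym (negbTE l'j) mul0r.
    by rewrite w0 ?mulr0.
  rewrite ffunE ffunE; case: ifP => // _; rewrite big1 // => l _.
  have [lt_jl | le_lj] := ltnP j l; first by rewrite w0 ?mulr0.
  rewrite (H_lower Hh') ?(leq_trans le_lj) 1?ltnW //.
  by case: eqP (leq_ltn_trans le_lj lt_ji) => [->|_ _]; rewrite ?ltnn ?mul0r.
(* Since [w j = c], this matrix adds [u i - w i] to each place [i] with [s <= i < j], and so carries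
   [w] to [u] on row [a]. *)
pose A := \matrix_(i, l) ((i == l)%:R
  + if (l == j) && (s <= i < j)%N then (u i - w i) / c else 0 : F).
have [h Hh hA] : exists2 h, h \in H & forall i l, GLval h i l = A i l.
  apply: pattern_matrix (pH) _ => i l; rewrite mxE.
  case: ifP => [/and3P[/eqP-> le_si lt_ij] | _]; last by rewrite addr0.
  rewrite /del_row chainS // andbT negbK => /eqP Di.
  by rewrite Di leqNgt a_lt_s in le_si.
exists (h^-1)%g; first by rewrite groupV (subsetP sHG).
rewrite conj_lam ?groupV // invgK; apply/row_char_eqP=> i; rewrite Sa => le_si.
rewrite ffunE.
under eq_bigr do rewrite hA mxE mulrDl.
rewrite big_split /= (bigD1 i) //= eqxx mul1r big1 ?addr0 => [|l l'i]; last first.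
  by rewrite eq_sym (negbTE l'i) mul0r.
rewrite (bigD1 j) //= eqxx [X in _ + (_ + X)]big1 ?addr0 => [|l l'j]; last first.
  by rewrite (negbTE l'j) mul0r.
rewrite le_si /=; case: ltngtP => [lt_ij | lt_ji | /val_inj->].
- by rewrite wj divfK // addrC subrK.
- by rewrite mul0r addr0 u0 ?w0.
by rewrite mul0r addr0 uj wj.
Qed.

(** Exactly the entries in the [j - s] places from [s] up to, but not including, [j] are free. *)
Lemma card_row_char_orbit j c : (s <= j)%N -> #|orb j c| = (#|F| ^ (j - s))%N.
Proof.
move=> le_sj; rewrite -(card_ord_interval s j).
transitivity #|pffun_on (0 : F) [pred i : 'I_n.+1 | (s <= i < j)%N] predT|; last first.
  by rewrite card_pffun_on.
pose f (u : {ffun 'I_n.+1 -> F}) : {ffun 'I_n.+1 -> F} :=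
  [ffun i => if i == j then c else u i].
rewrite -[RHS](card_in_imset (f := f)) => [|u w /pffun_onP[/supportP u0 _]]; last first.
  move=> /pffun_onP[/supportP w0 _] /ffunP eqf; apply/ffunP=> i.
  have := eqf i; rewrite !ffunE; case: eqP => // -> _.
  by rewrite u0 ?w0 // inE ltnn andbF.
apply: eq_card => w.
apply/orbP/imsetP=> [[/row_char_domP Ww wj w0]
                    | [u /pffun_onP[/supportP u0 _] ->]].
  exists [ffun i => if i == j then 0 else w i]; last first.
    by apply/ffunP=> i; rewrite !ffunE; case: eqP => // ->.
  apply/pffun_onP; split=> [|//]; apply/supportP=> i; rewrite inE ffunE.
  case: (eqVneq i j) => // i'j; rewrite negb_and -ltnNge -leqNgt.
  case/orP=> [lt_is | le_ji]; first by rewrite Ww // Sa -ltnNge.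
  by apply: w0; rewrite ltn_neqAle le_ji andbT eq_sym (inj_eq val_inj).
split=> [||i lt_ji].
- apply/row_char_domP=> i; rewrite Sa -ltnNge => lt_is; rewrite ffunE.
  case: eqP lt_is => [->|_ lt_is]; first by rewrite ltnNge le_sj.
  by rewrite u0 // inE leqNgt lt_is.
- by rewrite ffunE eqxx.
rewrite ffunE; case: eqP lt_ji => [->|_ lt_ji]; first by rewrite ltnn.
by rewrite u0 // inE ltnNge (ltnW lt_ji) andbF.
Qed.

(** From [S a i] and [S i l] follows [S a l], so an entry removed from column [j] is never a
    composite of remaining ones. *)
Lemma stab_rel_rel j : pattern_rel (stab_rel S a j).
Proof.
have [trS ltS] := pS; have [trH ltH] := pH; rewrite /stab_rel.
split=> [l i m /andP[Hil nil] /andP[Hlm nlm] | i l /andP[/ltH] //].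
rewrite (trH _ _ _ Hil Hlm) /=; apply: contra nlm => /andP[-> Sai].
by apply: trS Sai _; have /andP[] := Hil.
Qed.

Let rep j (c : F) : {ffun 'I_n.+1 -> F} := [ffun i => if i == j then c else 0].

Let rep_orb j c : (s <= j)%N -> rep j c \in orb j c.
Proof.
move=> le_sj; apply/orbP; split=> [||i lt_ji].
- apply/row_char_domP=> i; rewrite Sa ffunE; case: eqP => // ->.
  by rewrite le_sj.
- by rewrite ffunE eqxx.
by rewrite ffunE; case: eqP lt_ji => // ->; rewrite ltnn.
Qed.

(** Acting on [c] times the [j]-th unit vector gives [c] times column [j] of [h], so [h] fixes the
    character when that column is trivial at the places of row [a]. *)
Lemma row_char_Inertia_rep j c : (s <= j)%N -> c != 0 ->
  'I_H['chi_(lam (rep j c))]%G = pattern_group F n (stab_rel S a j).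
Proof.
move=> le_sj nz_c; apply/group_inj/setP=> h.
have act_rep i : row_act h (rep j c) i = GLval h i j * c.
  rewrite ffunE (bigD1 j) //= ffunE eqxx big1 ?addr0 // => l /negbTE l'j.
  by rewrite ffunE l'j mulr0.
apply/idP/(pattern_groupP (stab_rel_rel j)) => [/row_char_Inertia[Hh hw] i l | hS].
  rewrite negb_and negbK (inj_eq val_inj) => /orP[nHil | /andP[/eqP-> Sai]].
    exact: (pattern_groupP pH Hh).
  apply/(mulIf nz_c); rewrite -act_rep hw // ffunE.
  by case: eqP; rewrite ?mul1r ?mul0r.
apply/row_char_Inertia; split=> [|i Sai].
  by apply/(pattern_groupP pH) => i l nHil; apply: hS; rewrite negb_and nHil.
rewrite act_rep hS ?ffunE; first by case: eqP; rewrite ?mul1r ?mul0r.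
by rewrite negb_and eqxx Sai orbT.
Qed.

Lemma sum_orbit (k : nat) j c : (s <= j)%N -> c != 0 ->
  \sum_(w in orb j c) (num_irr_over G (lam w) k)%:R / #|G : 'I_G['chi_(lam w)]|%:R
   = (if (#|F| ^ (j - s) %| k)%N
      then num_irr_deg (pattern_group F n (stab_rel S a j)) (k %/ #|F| ^ (j - s))
      else 0%N)%:R :> rat.
Proof.
move=> le_sj nz_c; have [nsVG _ _ _ _] := sdprod_context sdprod_row.
have inj_orb: {in orb j c &, injective lam}.
  by move=> u w /orbP[Wu _ _] /orbP[Ww _ _]; apply: row_char_inj.
have orbE := row_char_orbit le_sj nz_c (rep_orb c le_sj).
rewrite -(big_imset (fun t => (num_irr_over G t k)%:R / #|G : 'I_G['chi_t]|%:R) inj_orb).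
rewrite -orbE sum_num_irr_over_cfclass // num_irr_over_row.
rewrite -card_cfclass_Iirr // orbE card_in_imset // card_row_char_orbit //.
by rewrite row_char_Inertia_rep.
Qed.

(** The zero vector contributes the count for H. The other vectors are sorted by the place and the
    value of their last nonzero entry, and the factor [#|F|.-1] counts the values. *)
Lemma num_irr_deg_chain (k : nat) :
  num_irr_deg G k = (num_irr_deg H k + #|F|.-1 * \sum_(j < n.+1 | s <= j)
    if (#|F| ^ (j - s) %| k)%N
    then num_irr_deg (pattern_group F n (stab_rel S a j)) (k %/ #|F| ^ (j - s)) else 0)%N.
Proof.
have [nsVG _ _ _ _] := sdprod_context sdprod_row.
apply/eqP; rewrite -(eqr_nat rat) (num_irr_deg_sum_over k nsVG) sum_row_char.
have W_0 : 0 \in W0 by apply/row_char_domP=> j _; rewrite ffunE.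
rewrite (bigD1 (0 : {ffun 'I_n.+1 -> F})) //= natrD; apply/eqP; congr (_ + _).
  have [|idx IH] := @row_char_invariant 0.
    by move=> h i _ _; rewrite ffunE big1 ?ffunE // => j _; rewrite ffunE mulr0.
  by rewrite num_irr_over_row idx dvd1n divn1 divr1 IH.
(* The place of the last nonzero entry, with default 0 for the zero vector, which has been split
   off. *)
pose top w : 'I_n.+1 := inord (\max_(i < n.+1 | w i != 0) i).
have topP w : w != 0 -> w (top w) != 0 /\ forall i : 'I_n.+1, (top w < i)%N -> w i = 0.
  move=> nz_w.
  have [i0 nz_wi0] : exists i, w i != 0.
    apply/existsP; apply: contraNT nz_w => /existsPn w0.
    by apply/eqP/ffunP=> i; rewrite ffunE; apply/eqP; have := w0 i; rewrite negbK.
  have [|i nz_wi max_i] := @eq_bigmax_cond _ [pred i | w i != 0] (fun i : 'I_n.+1 => i : nat).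
    by apply/card_gt0P; exists i0.
  have Dtop: top w = i by apply: val_inj; rewrite /= inordK max_i.
  rewrite Dtop; split=> // l lt_il; apply/eqP; apply: contraLR lt_il => nz_wl.
  by rewrite -leqNgt -max_i; apply: (leq_bigmax_cond (P := [pred i | w i != 0])).
rewrite (partition_big (fun w => (top w, w (top w)))
  (fun p => (s <= p.1)%N && (p.2 != 0))) => [|w /andP[/row_char_domP Ww nz_w]]; last first.
  have [nz_wt _] := topP w nz_w; rewrite /= nz_wt andbT.
  by rewrite -Sa; apply: contraR nz_wt => /Ww->.
rewrite -(pair_big (fun j : 'I_n.+1 => (s <= j)%N) (fun c : F => c != 0) (fun j c =>
   \sum_(w | (w \in W0) && (w != 0) && ((top w, w (top w)) == (j, c)))
     (num_irr_over G (lam w) k)%:R / #|G : 'I_G['chi_(lam w)]|%:R)) /=.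
rewrite natrM natr_sum mulr_sumr; apply: eq_bigr => j le_sj.
rewrite (eq_bigr (fun=> (if (#|F| ^ (j - s) %| k)%N
      then num_irr_deg (pattern_group F n (stab_rel S a j)) (k %/ #|F| ^ (j - s))
      else 0%N)%:R)) => [|c nz_c].
  rewrite sumr_const mulr_natl; congr (_ *+ _).
  by rewrite -(cardC1 (0 : F)); apply: eq_card => c; rewrite !inE.
rewrite -(sum_orbit k le_sj nz_c); apply: eq_bigl => w.
apply/andP/orbP=> [[/andP[Ww nz_w] /eqP[<- <-]] | [Ww wj w0]].
  by have [_ w0] := topP w nz_w.
have nz_w: w != 0 by apply: contraNneq nz_c => w_0; rewrite -wj w_0 ffunE.
rewrite Ww nz_w; split=> //; have [nz_wt wt0] := topP w nz_w.
suffices ->: top w = j by rewrite wj.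
apply: ord_inj; apply/eqP; rewrite eqn_leq; apply/andP; split; rewrite leqNgt.
  by apply: contra nz_wt => /w0->.
by apply/negP=> /wt0 wj0; rewrite -wj wj0 eqxx in nz_c.
Qed.

End Chain.

End RowChar.

End Row.

Lemma num_lin_char_pattern (F : finFieldType) (n : nat) S (a : 'I_n.+1) :
    pattern_rel S -> (forall i, ~~ S i a) ->
  num_irr_deg (pattern_group F n S) 1
    = (#|F| ^ #|[pred j : 'I_n.+1 | S a j && [forall k : 'I_n.+1, S a k ==> ~~ S k j]]|
       * num_irr_deg (pattern_group F n (del_row S a)) 1)%N.
Proof.
move=> pS minS; have [psi [psiD psi0 psi_nd]] := nontrivial_add_char F.
have [lam lamE] := exists_row_char pS minS psiD psi0.
exact: num_lin_char_row lamE.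
Qed.

Lemma num_irr_deg_pattern (F : finFieldType) (n : nat) S (a : 'I_n.+1) (s k : nat) :
    pattern_rel S -> (forall i, ~~ S i a) ->
    (forall j : 'I_n.+1, S a j = (s <= j)%N) ->
    (forall i j : 'I_n.+1, (s <= i)%N -> (i < j)%N -> S i j) ->
  num_irr_deg (pattern_group F n S) k
    = (num_irr_deg (pattern_group F n (del_row S a)) k
       + #|F|.-1 * \sum_(j < n.+1 | s <= j) if (#|F| ^ (j - s) %| k)%N
           then num_irr_deg (pattern_group F n (stab_rel S a j)) (k %/ #|F| ^ (j - s))
           else 0)%N.
Proof.
move=> pS minS Sa chainS; have [psi [psiD psi0 psi_nd]] := nontrivial_add_char F.
have [lam lamE] := exists_row_char pS minS psiD psi0.
exact: num_irr_deg_chain lamE _ Sa chainS k.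
Qed.

(** * Counts for the pattern groups involved *)

(** As [q > 1], divisibility means [j - s <= e]; put [i = j - s]. *)
Lemma sum_dvdn_expn (q s N e : nat) (f : nat -> nat -> nat) : (1 < q)%N ->
  (\sum_(j < N | s <= j) (if q ^ (j - s) %| q ^ e then f j (q ^ e %/ q ^ (j - s)) else 0)
   = \sum_(i < e.+1 | s + i < N) f (s + i) (q ^ (e - i)))%N.
Proof.
move=> q_gt1; have q_gt0 := ltnW q_gt1.
pose g i := f (s + i)%N (q ^ (e - i))%N.
transitivity (\sum_(0 <= i < N - s) if (i <= e)%N then g i else 0)%N.
  rewrite -(big_mkord (fun j => s <= j)%N (fun j =>
    if q ^ (j - s) %| q ^ e then f j (q ^ e %/ q ^ (j - s)) else 0))%N.
  have [le_sN | lt_Ns] := leqP s N; last first.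
    rewrite [RHS]big_geq; last by lia.
    by rewrite big_nat_cond big1 // => j; lia.
  rewrite (big_cat_nat (n := s)) //= big_nat_cond big1 ?add0n; last by move=> j; lia.
  rewrite -{1}[s]add0n big_addn big_nat_cond [RHS]big_nat_cond.
  apply: eq_big => [i|i _]; first by lia.
  rewrite addnK dvdn_Pexp2l //; case: leqP => // le_ie.
  by rewrite -expnB // addnC.
rewrite -big_mkcond /= big_mkord.
(* Both sums are extended to a common range and then differ only in how the condition is written. *)
rewrite (big_ord_widen_cond (N + e.+1) (fun i => i <= e)%N g); last by lia.
rewrite (big_ord_widen_cond (N + e.+1) (fun i => s + i < N)%N g); last by lia.
by apply: eq_bigl => i; lia.
Qed.

Lemma pattern_group_trivial (F : finFieldType) n S :
  pattern_rel S -> (forall i j : 'I_n.+1, ~~ S i j) -> pattern_group F n S = 1%G.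
Proof.
move=> pS S0; apply/group_inj/trivgP/subsetP=> g /(pattern_groupP pS) gS.
by rewrite inE; apply/eqP/GL_eqP=> i j; rewrite GL_one_entry gS.
Qed.

Lemma num_irr_deg1 (gT : finGroupType) k : num_irr_deg (1%G : {group gT}) k = (k == 1%N).
Proof.
have := abelian1 gT; rewrite card_classes_abelian cards1 -NirrE => /eqP N1.
have deg1 i : ('chi[1%G : {group gT}]_i 1%g == k%:R) = (k == 1%N).
  rewrite lin_char1; last exact/char_abelianP/abelian1.
  by rewrite -(eqr_nat algC) eq_sym.
rewrite /num_irr_deg; under eq_finset do rewrite deg1.
by case: eqP => _; rewrite ?cardsT ?card_ord ?cards0.
Qed.

Lemma card_ord_eq N x : #|[pred j : 'I_N | (j : nat) == x]| = (x < N)%N.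
Proof.
case: ltnP => [lt_xN | le_Nx].
  transitivity #|pred1 (Ordinal lt_xN)|; last by rewrite card1.
  by apply: eq_card => j; rewrite !inE.
by apply: eq_card0 => j; rewrite !inE; have := ltn_ord j; lia.
Qed.

(* Iterating [stab_rel] from a triangle: the stabilisers at the second and third
   places of the top row of [triangle a] are [gap1 a.+1] and [gap2 a.+1], and the
   one at the second place of the top row of [gap1 b] is [gap3 b.+1]. *)
Definition gap1 (b : nat) : rel nat :=
  fun i j => triangle b i j && ~~ ((i == b) && (j == b.+1)).

Definition gap2 (b : nat) : rel nat :=
  fun i j => triangle b i j && ~~ ((i <= b.+1)%N && (j == b.+2)).

Definition gap3 (b : nat) : rel nat :=
  fun i j => triangle b i j && ~~ ((i == b.+1) && (j == b.+2)).

Lemma gap1_rel b : pattern_rel (gap1 b).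
Proof. by rewrite /gap1 /triangle; split=> [j i k|i j]; lia. Qed.

Lemma gap2_rel b : pattern_rel (gap2 b).
Proof. by rewrite /gap2 /triangle; split=> [j i k|i j]; lia. Qed.

Lemma gap3_rel b : pattern_rel (gap3 b).
Proof. by rewrite /gap3 /triangle; split=> [j i k|i j]; lia. Qed.

(** * Linear characters of triangles with and without gaps *)

Section Counting.

Variables (F : finFieldType) (n : nat).
Let q := #|F|.
Let L S := num_irr_deg (pattern_group F n S) 1.

Let q_gt1 : (1 < q)%N. Proof. exact: card_finNzRing_gt1. Qed.

(** Restated over natural numbers, so that for concrete patterns the hypotheses fall to [lia]. *)
Lemma num_lin_char_step S S' (a : nat) (X : pred nat) :
    (a <= n)%N -> pattern_rel S -> (forall i, ~~ S i a) ->
    (forall i j, del_row S a i j = S' i j) ->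
    (forall j, X j <-> S a j /\ forall k, S a k -> ~~ S k j) ->
  L S = (q ^ #|[pred j : 'I_n.+1 | X j]| * L S')%N.
Proof.
move=> le_an pS minS delS XP; have ltan : (a < n.+1)%N by [].
rewrite /L (num_lin_char_pattern F (a := Ordinal ltan) pS minS) /=.
congr (_ ^ _ * _)%N; last by congr num_irr_deg; apply: eq_pattern_group.
apply: eq_card => j; rewrite !inE; apply/andP/idP => [[Saj /forallP Sj] | /XP[Saj Sj]].
  apply/XP; split=> // k Sak; apply/negP=> Skj.
  (* [S k j] forces [k < j], so [k] is an index of the matrix. *)
  have ltk : (k < n.+1)%N by case: pS => _ /(_ _ _ Skj)/ltn_trans->.
  by have /implyP/(_ Sak)/negP := Sj (Ordinal ltk).
by split=> //; apply/forallP=> k; apply/implyP/Sj.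
Qed.

(** In each row only the place next to the diagonal is indecomposable. *)
Lemma num_lin_triangle a : L (triangle a) = (q ^ (n - a))%N.
Proof.
have [m] := ubnP (n - a)%N; elim: m a => // m IH a /ltnSE le_m.
have [le_na | lt_an] := leqP n a.
  rewrite /L pattern_group_trivial ?num_irr_deg1; last first.
  - by move=> i j; rewrite /triangle; have := ltn_ord j; lia.
  - exact: triangle_rel.
  by have ->: (n - a = 0)%N by lia.
rewrite (num_lin_char_step (S' := triangle a.+1) (a := a) (X := pred1 a.+1)).
- rewrite card_ord_eq IH; last by lia.
  by rewrite -expnD; congr (_ ^ _)%N; lia.
- exact: ltnW.
- exact: triangle_rel.
- by move=> i; rewrite /triangle; lia.
- by move=> i j; rewrite /del_row /triangle; lia.
move=> j; rewrite /triangle /=; split=> [/eqP->|[aj /(_ a.+1)]]; last by lia.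
by split=> [|k]; lia.
Qed.

(** The top row has the single indecomposable place [b.+2]; the Boolean in the exponent tells
    whether it exists. *)
Lemma num_lin_gap1 b : L (gap1 b) = (q ^ ((b.+1 < n) + (n - b.+1)))%N.
Proof.
have [lt_nb | le_bn] := ltnP n b.
  rewrite /L pattern_group_trivial ?num_irr_deg1; last first.
  - by move=> i j; rewrite /gap1 /triangle; have := ltn_ord j; lia.
  - exact: gap1_rel.
  by have ->: ((b.+1 < n) + (n - b.+1) = 0)%N by lia.
rewrite (num_lin_char_step (S' := triangle b.+1) (a := b) (X := pred1 b.+2)) //.
- by rewrite card_ord_eq num_lin_triangle -expnD; congr (_ ^ _)%N; lia.
- exact: gap1_rel.
- by move=> i; rewrite /gap1 /triangle; lia.
- by move=> i j; rewrite /del_row /gap1 /triangle; lia.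
move=> j; rewrite /gap1 /triangle /=; split=> [/eqP->|[aj /(_ b.+2)]]; last by lia.
by split=> [|k]; lia.
Qed.

(** In the top row every place after [b.+1] is reached through [b.+1]; deleting the row leaves
    [gap1 b.+1]. *)
Lemma num_lin_gap2 b : (b.+1 < n)%N ->
  L (gap2 b) = (q ^ ((b.+2 < n) + (n - b.+1)))%N.
Proof.
move=> lt_bn.
rewrite (num_lin_char_step (S' := gap1 b.+1) (a := b) (X := pred1 b.+1)).
- by rewrite card_ord_eq num_lin_gap1 -expnD; congr (_ ^ _)%N; lia.
- by lia.
- exact: gap2_rel.
- by move=> i; rewrite /gap2 /triangle; lia.
- by move=> i j; rewrite /del_row /gap2 /gap1 /triangle; lia.
move=> j; rewrite /gap2 /triangle /=; split=> [/eqP->|[aj /(_ b.+1)]]; last by lia.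
by split=> [|k]; lia.
Qed.

(** The missing entry makes [b.+2] indecomposable along with [b.+1], so the top row contributes
    [q ^ 2]. *)
Lemma num_lin_gap3 b : (b.+1 < n)%N ->
  L (gap3 b) = (q ^ ((b.+2 < n) + (n - b)))%N.
Proof.
move=> lt_bn.
rewrite (num_lin_char_step (S' := gap1 b.+1) (a := b) (X := pred2 b.+1 b.+2)).
- rewrite -(cardID [pred j : 'I_n.+1 | (j : nat) == b.+1]).
  rewrite (eq_card (B := [pred j : 'I_n.+1 | (j : nat) == b.+1])); last first.
    by move=> j; rewrite !inE /=; lia.
  rewrite [X in (_ + X)%N](eq_card (B := [pred j : 'I_n.+1 | (j : nat) == b.+2])); last first.
    by move=> j; rewrite !inE /=; lia.
  by rewrite !card_ord_eq num_lin_gap1 -expnD; congr (_ ^ _)%N; lia.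
- by lia.
- exact: gap3_rel.
- by move=> i; rewrite /gap3 /triangle; lia.
- by move=> i j; rewrite /del_row /gap3 /gap1 /triangle; lia.
move=> j; rewrite /gap3 /triangle /=; split=> [/orP[/eqP->|/eqP->]|[aj /(_ b.+1)]]; last by lia.
  by split=> [|k]; lia.
by split=> [|k]; lia.
Qed.

(** * Characters of degree [q] and [q ^ 2] *)

Let N e S := num_irr_deg (pattern_group F n S) (q ^ e).

(** [R m] is the stabiliser pattern for place [s + m], whose orbits have size [q ^ m]; what remains
    is the degree [q ^ (e - m)]. *)
Lemma num_irr_deg_step S S' (a s e : nat) (R : nat -> rel nat) :
    (a <= n)%N -> pattern_rel S -> (forall i, ~~ S i a) ->
    (forall j, S a j = (s <= j)%N) -> (forall i j, (s <= i < j)%N -> S i j) ->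
    (forall i j, del_row S a i j = S' i j) ->
    (forall m, (m <= e)%N -> forall i j, stab_rel S a (s + m) i j = R m i j) ->
  N e S = (N e S' + q.-1 * \sum_(m < e.+1) if s + m <= n then N (e - m) (R m) else 0)%N.
Proof.
move=> le_an pS minS Sa chainS delS chainR; have ltan : (a < n.+1)%N by [].
rewrite /N (num_irr_deg_pattern (a := Ordinal ltan) (s := s) F _ pS minS) //=.
  rewrite (sum_dvdn_expn s n.+1 e (fun j => num_irr_deg (pattern_group F n (stab_rel S a j)))) //.
  rewrite (eq_pattern_group F (fun i j : 'I_n.+1 => delS i j)) big_mkcond /=; congr (_ + _ * _)%N.
  apply: eq_bigr => m _; rewrite ltnS; case: ifP => // _.
  by congr num_irr_deg; apply: eq_pattern_group => i j; rewrite chainR ?expnB // -ltnS.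
by move=> i j le_si lt_ij; apply: chainS; rewrite le_si.
Qed.

(** Clearing column [a.+1] removes nothing below the top row; the next two columns give the gaps. By
    [e <= 2] the default of [nth] is never read. *)
Lemma num_irr_deg_triangle_step a e : (e <= 2)%N -> (a <= n)%N ->
  N e (triangle a) = (N e (triangle a.+1) + q.-1 * \sum_(m < e.+1)
    if a.+1 + m <= n
    then N (e - m) (nth (triangle a.+1) [:: triangle a.+1; gap1 a.+1; gap2 a.+1] m) else 0)%N.
Proof.
move=> le_e2 le_an; apply: (num_irr_deg_step (a := a) (s := a.+1)) => //.
- exact: triangle_rel.
- by move=> i; rewrite /triangle; lia.
- by move=> j; rewrite /triangle; lia.
- by move=> i j; rewrite /triangle; lia.
- by move=> i j; rewrite /del_row /triangle; lia.
by case=> [|[|[|m]]] le_me i j; rewrite /= /stab_rel /del_row /gap1 /gap2 /triangle; lia.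
Qed.

(** The top row starts at [b.+2]. Clearing column [b.+2] removes nothing, and clearing column [b.+3]
    removes only its entry in row [b.+2], since [b.+1] is not a place of the top row. *)
Lemma num_irr_deg_gap1_step b : (b <= n)%N ->
  N 1 (gap1 b) = (N 1 (triangle b.+1)
    + q.-1 * ((if b.+2 <= n then N 1 (triangle b.+1) else 0)
              + if b.+3 <= n then L (gap3 b.+1) else 0))%N.
Proof.
move=> le_bn.
rewrite (num_irr_deg_step (S' := triangle b.+1) (a := b) (s := b.+2)
  (R := nth (triangle b.+1) [:: triangle b.+1; gap3 b.+1])) //.
- by rewrite !big_ord_recl big_ord0 /= /bump /= !addn0 addn1.
- exact: gap1_rel.
- by move=> i; rewrite /gap1 /triangle; lia.
- by move=> j; rewrite /gap1 /triangle; lia.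
- by move=> i j; rewrite /gap1 /triangle; lia.
- by move=> i j; rewrite /del_row /gap1 /triangle; lia.
by case=> [|[|m]] // le_me i j; rewrite /= /stab_rel /del_row /gap1 /gap3 /triangle; lia.
Qed.

Lemma num_irr_deg_triangle1_step a : (a <= n)%N ->
  N 1 (triangle a) = (N 1 (triangle a.+1)
    + q.-1 * ((if a.+1 <= n then N 1 (triangle a.+1) else 0)
              + if a.+2 <= n then L (gap1 a.+1) else 0))%N.
Proof.
move=> le_an; rewrite num_irr_deg_triangle_step //.
by rewrite !big_ord_recl big_ord0 /= /bump /= !addn0 addn1.
Qed.

Lemma num_irr_deg_triangle2_step a : (a <= n)%N ->
  N 2 (triangle a) = (N 2 (triangle a.+1)
    + q.-1 * ((if a.+1 <= n then N 2 (triangle a.+1) else 0)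
              + ((if a.+2 <= n then N 1 (gap1 a.+1) else 0)
                 + if a.+3 <= n then L (gap2 a.+1) else 0)))%N.
Proof.
move=> le_an; rewrite num_irr_deg_triangle_step //.
by rewrite !big_ord_recl big_ord0 /= /bump /= !addn0 addn1 addn2.
Qed.

Lemma num_irr_deg_triangle_top a e : (n <= a)%N -> (0 < e)%N -> N e (triangle a) = 0%N.
Proof.
move=> le_na e_gt0; rewrite /N pattern_group_trivial ?num_irr_deg1.
- by rewrite gtn_eqF // -(expn0 q) ltn_exp2l.
- exact: triangle_rel.
by move=> i j; rewrite /triangle; have := ltn_ord j; lia.
Qed.

Let qE : q = q.-1.+1. Proof. by rewrite prednK // ltnW. Qed.

Lemma num_irr_deg_q_triangle_small a : (n <= a.+1)%N -> N 1 (triangle a) = 0%N.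
Proof.
move=> le_na; have [?|?] := leqP n a; first exact: num_irr_deg_triangle_top.
rewrite num_irr_deg_triangle1_step ?(@num_irr_deg_triangle_top a.+1) //; try lia.
by repeat (case: ifP => [|] ?; try lia).
Qed.

(** A unitriangular group of size [m + 3]: its count is [q] times that of the next smaller size plus
    [q - 1] times the number of linear characters of [gap1 a.+1]. *)
Lemma num_irr_deg_q_triangle m a : (a + m.+2 = n)%N ->
  N 1 (triangle a) = (q ^ m * q.-1 * (1 + m * q))%N.
Proof.
elim: m a => [|m IH] a Dn; rewrite num_irr_deg_triangle1_step ?num_lin_gap1; try lia.
  rewrite num_irr_deg_q_triangle_small; last by lia.
  repeat (case: ifP => [|] ?; try lia).
  have -> : ((a.+2 < n) + (n - a.+2) = 0)%N by lia.
  by rewrite expn0; lia.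
repeat (case: ifP => [|] ?; try lia).
have -> : ((a.+2 < n) + (n - a.+2) = m.+2)%N by lia.
rewrite (IH a.+1); last by lia.
(* With [q ^ m] and [q - 1] generalised, a polynomial identity in natural numbers remains. *)
rewrite !expnS; move: (q ^ m)%N => p; rewrite [q]qE /=; move: q.-1 => v.
by nia.
Qed.

Lemma num_irr_deg_q2_triangle3 a : (a + 2 = n)%N -> N 2 (triangle a) = 0%N.
Proof.
move=> Dn; rewrite num_irr_deg_triangle2_step ?num_irr_deg_gap1_step; try lia.
rewrite (num_irr_deg_triangle2_step (a := a.+1)); last by lia.
rewrite !(@num_irr_deg_triangle_top a.+2) //; try lia.
by repeat (case: ifP => [|] ?; try lia).
Qed.

Lemma num_irr_deg_q2_triangle4 a : (a + 3 = n)%N -> N 2 (triangle a) = (q.-1 * q)%N.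
Proof.
move=> Dn; rewrite num_irr_deg_triangle2_step ?num_irr_deg_gap1_step; try lia.
rewrite (@num_irr_deg_q2_triangle3 a.+1) ?num_lin_gap2; try lia.
rewrite num_irr_deg_q_triangle_small; last by lia.
have -> : ((a.+3 < n) + (n - a.+2) = 1)%N by lia.
by rewrite expn1; repeat (case: ifP => [|] ?; try lia).
Qed.

(** The base case, size 5, is separate: [gap3 a.+2] reaches the last column, which costs it a factor
    [q] compared with larger sizes. *)
Lemma num_irr_deg_q2_triangle5 a : (a + 4 = n)%N ->
  N 2 (triangle a) = (q * q.-1 * (q + q.-1 + q * q.-1 + q ^ 2))%N.
Proof.
move=> Dn; rewrite num_irr_deg_triangle2_step ?num_irr_deg_gap1_step; try lia.
rewrite (@num_irr_deg_q2_triangle4 a.+1) ?num_lin_gap2 ?num_lin_gap3; try lia.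
rewrite (@num_irr_deg_q_triangle 0 a.+2); try lia.
have -> : ((a.+3 < n) + (n - a.+2) = 3)%N by lia.
have -> : ((a.+4 < n) + (n - a.+2) = 2)%N by lia.
by repeat (case: ifP => [|] ?; try lia).
Qed.

(** Both gap patterns have [q ^ m.+4] linear characters, with coefficients [q - 1] and 1, which add
    up to [q]. *)
Lemma num_irr_deg_q2_triangle_step m a : (a + m + 5 = n)%N ->
  N 2 (triangle a) = (q * N 2 (triangle a.+1) + q.-1 * (q * (q ^ m.+1 * q.-1 * (1 + m.+1 * q))
     + q ^ m.+4 * q))%N.
Proof.
move=> Dn; rewrite num_irr_deg_triangle2_step ?num_irr_deg_gap1_step; try lia.
rewrite (@num_irr_deg_q_triangle m.+1 a.+2) ?num_lin_gap2 ?num_lin_gap3; try lia.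
have -> : ((a.+3 < n) + (n - a.+2) = m.+4)%N by lia.
have -> : ((a.+4 < n) + (n - a.+2) = m.+4)%N by lia.
by repeat (case: ifP => [|] ?; try lia).
Qed.

(** The group has size [m + 5]. Over the rationals the subtractions and halves are exact, so [field]
    settles the induction. *)
Lemma num_irr_deg_q2_triangle m a : (a + m + 4 = n)%N ->
  (N 2 (triangle a))%:R = (q%:R : rat) ^+ m.+1 * (q%:R - 1)
    * (m%:R * q%:R ^+ 3 + (m%:R * (m%:R + 1) / 2 + 2) * q%:R ^+ 2
       + (1 - (m%:R - 1) * m%:R / 2) * q%:R - m%:R - 1).
Proof.
have Dv : (q.-1)%:R = q%:R - 1 :> rat by rewrite -subn1 natrB // ltnW.
elim: m a => [|m IH] a Dn.
  rewrite num_irr_deg_q2_triangle5; last by lia.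
  by rewrite !(natrM, natrD, natrX) Dv; field.
rewrite (@num_irr_deg_q2_triangle_step m); last by lia.
rewrite natrD natrM IH; last by lia.
rewrite !(natrM, natrD, natrX) Dv -[m.+1%:R]natr1 !exprS.
by field.
Qed.

End Counting.

(** * The formulas for the full unitriangular group *)

Lemma num_irr_deg_UT_q2 (F : finFieldType) n : (5 <= n)%N ->
  (num_irr_deg (UT_group F n) (#|F| ^ 2))%:R = (#|F|%:R : rat) ^+ (n - 4) * (#|F|%:R - 1)
    * ((n%:R - 5) * #|F|%:R ^+ 3 + ((n%:R - 5) * (n%:R - 4) / 2 + 2) * #|F|%:R ^+ 2
       + (1 - (n%:R - 6) * (n%:R - 5) / 2) * #|F|%:R - n%:R + 4).
Proof.
case: n => [//|n] le5n; rewrite UT_pattern.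
(* The size is now [n.+1], so [n - 4] is the size minus 5. *)
have Dn : (0 + (n - 4) + 4 = n)%N by lia.
rewrite (num_irr_deg_q2_triangle F Dn).
have -> : (n.+1 - 4 = (n - 4).+1)%N by lia.
have -> : n.+1%:R = (n - 4)%:R + 5 :> rat by rewrite -natrD; congr _%:R; lia.
by field.
Qed.

(** Supplies integers for the halved products in the coefficients. *)
Lemma bin2_rat (m : nat) : ('C(m, 2))%:R = m%:R * (m%:R - 1) / 2 :> rat.
Proof.
have := mul_bin_diag m 1; rewrite bin1 => /(congr1 (fun x => x%:R : rat)).
rewrite !natrM => E; apply: (mulfI (_ : 2 != 0 :> rat)) => //; rewrite -E.
by case: m {E} => [|m] /=; rewrite ?mul0r ?mulr0 // -natr1; field.
Qed.

Lemma map_poly_intr_quartic (k : nat) (a b c d e : int) :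
  map_poly (intr : int -> rat) ('X^k * ('X - 1)
    * (a%:P * 'X^3 + b%:P * 'X^2 + c%:P * 'X - d%:P + e%:P))
  = 'X^k * ('X - 1) * (a%:~R%:P * 'X^3 + b%:~R%:P * 'X^2 + c%:~R%:P * 'X - d%:~R%:P + e%:~R%:P).
Proof.
rewrite rmorphM rmorphM rmorphB !rmorphD rmorphN rmorph1.
rewrite [X in _ * (X + _ + _ - _ + _)]rmorphM [X in _ * (_ + X + _ - _ + _)]rmorphM.
rewrite [X in _ * (_ + _ + X - _ + _)]rmorphM /=.
by rewrite !map_polyXn !map_polyC map_polyX.
Qed.

(** The orders of finite fields are exactly the prime powers. Choosing [P] before the field
    expresses that its coefficients depend on [n] only. *)
Theorem mainTheorem2 :
  (forall F : finFieldType,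
     let q : rat := #|F|%:R in
     let N (n : nat) : rat := (num_irr_deg (UT_group F n) (#|F| ^ 2))%:R in
     [/\ N 5%N = q * (q - 1) * (2 * q ^+ 2 + q - 1),
         forall n : nat, (6 <= n)%N ->
           N n = q * N n.-1
                 + q ^+ (n - 4) * (q - 1)
                   * (q ^+ 3 + (n%:R - 5) * q ^+ 2 - (n%:R - 6) * q - 1)
       & forall n : nat, (5 <= n)%N ->
           N n = q ^+ (n - 4) * (q - 1)
                 * ((n%:R - 5) * q ^+ 3
                    + ((n%:R - 5) * (n%:R - 4) / 2 + 2) * q ^+ 2
                    + (1 - (n%:R - 6) * (n%:R - 5) / 2) * q - n%:R + 4)])
  /\ (forall n : nat, (5 <= n)%N ->
        exists P : {poly int},
          map_poly (intr : int -> rat) P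
            = 'X^(n - 4) * ('X - 1)
              * ((n%:R - 5)%:P * 'X^3
                 + ((n%:R - 5) * (n%:R - 4) / 2 + 2)%:P * 'X^2
                 + (1 - (n%:R - 6) * (n%:R - 5) / 2)%:P * 'X - n%:R%:P + 4%:P)
          /\ forall F : finFieldType,
               (num_irr_deg (UT_group F n) (#|F| ^ 2))%:Z = P.[#|F|%:Z]).
Proof.
split=> [F q N | n le5n].
  (* The value at 5 and the recurrence are both read off from the closed form. *)
  have closed n : (5 <= n)%N -> N n = _ := @num_irr_deg_UT_q2 F n.
  split=> [|n le6n|//]; first by rewrite closed //; rewrite -/q; field.
  rewrite !closed //; try lia.
  rewrite -/q; have [m ->] : exists m, n = m.+2.+4 by exists (n - 6)%N; lia.
  have -> : (m.+2.+4 - 4 = m.+2)%N by lia.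
  have -> : (m.+2.+4.-1 - 4 = m.+1)%N by lia.
  have -> : m.+2.+4%:R = m%:R + 6 :> rat by rewrite -natrD addnC.
  have -> : m.+2.+4.-1%:R = m%:R + 5 :> rat by rewrite -natrD addnC.
  by rewrite !exprS; field.
have [m Dn] : exists m, n = (m + 5)%N by exists (n - 5)%N; lia.
have DnR : n%:R = m%:R + 5 :> rat by rewrite Dn natrD.
(* With [m = n - 5], the halves [(n - 5)(n - 4) / 2] and [(n - 6)(n - 5) / 2] are the binomials
   ['C(m.+1, 2)] and ['C(m, 2)]. *)
pose P : {poly int} := 'X^(n - 4) * ('X - 1) * (m%:Z%:P * 'X^3
  + ('C(m.+1, 2) + 2)%:Z%:P * 'X^2 + (1 - 'C(m, 2)%:Z)%:P * 'X - n%:Z%:P + 4%:Z%:P).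
have map_P : map_poly (intr : int -> rat) P
            = 'X^(n - 4) * ('X - 1)
              * ((n%:R - 5)%:P * 'X^3
                 + ((n%:R - 5) * (n%:R - 4) / 2 + 2)%:P * 'X^2
                 + (1 - (n%:R - 6) * (n%:R - 5) / 2)%:P * 'X - n%:R%:P + 4%:P).
  rewrite map_poly_intr_quartic; congr (_ * (_%:P * _ + _%:P * _ + _%:P * _ - _ + _)).
  - by rewrite DnR pmulrn; ring.
  - by rewrite -pmulrn natrD bin2_rat DnR -natr1; field.
  by rewrite rmorphB /= -pmulrn bin2_rat DnR; field.
exists P; split=> // F.
apply: (@intr_inj rat); rewrite -horner_map map_P /=.
rewrite -!pmulrn num_irr_deg_UT_q2 //.
by rewrite !(hornerM, hornerD, hornerN, hornerXn, hornerX, hornerC).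
Qed.
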